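(* Let $(E,\|\cdot\|)$ be a normed $\mathbb{R}$-vector space. The following conditions are equivalent: 1. Every affine map $\gamma:[-1,1]\to E$ whose image is contained in the unit sphere is constant. 2. For all increasing, strictly convex maps $\psi:\mathbb{R}_+\to\mathbb{R}$, the composition $\psi\circ\|\cdot\|$ is strictly convex. 3. There exists an increasing, strictly convex map $\psi:\mathbb{R}_+\to\mathbb{R}$ such that the composition $\psi\circ\|\cdot\|$ is strictly convex.
   Context: $\mathbb{R}_+=[0,\infty)$. A continuous function $f:X\to\mathbb{R}$ on a convex subset $X$ of a topological real affine space $F$ is convex if for all affine maps $\gamma:[-1,1]\to F$ with values in $X$, $f(\gamma(0))\leq\frac{f(\gamma(-1))+f(\gamma(1))}{2}$; it is strictly convex if moreover this inequality is strict whenever $\gamma$ is non-constant. In particular, convex and strictly convex functions are continuous by definition. *)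

(* Defs.v *)
From HB Require Import structures.
From mathcomp Require Export all_boot all_order all_algebra.
From mathcomp Require Export all_classical all_reals all_analysis.

Set Implicit Arguments.
Unset Strict Implicit.
Unset Printing Implicit Defensive.

Import Order.TTheory GRing.Theory Num.Theory.
Import numFieldNormedType.Exports.

Local Open Scope classical_set_scope.
Local Open Scope ring_scope.
Local Open Scope convex_scope.

(* Maps and functions on a subset are represented by total functions, of which
   only the values on that subset matter. *)

Definition affine_on (R : numDomainType) (U V : lmodType R) (D : set U)
    (g : U -> V) : Prop :=
  forall (p : {i01 R}) (x y : U), D x -> D y ->
    g ((x : convex_lmodType U) <| p |> y) =
    (g x : convex_lmodType V) <| p |> g y.

Definition constant_on (T U : Type) (D : set T) (g : T -> U) : Prop :=
  forall x y : T, D x -> D y -> g x = g y.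

(* [-1, 1] as a subset of the real line [R^o] seen as a vector space. *)
Definition segment (R : realType) : set R^o := `[-1, 1].

Definition affine_segment (R : realType) (F : lmodType R) (X : set F)
    (g : R^o -> F) : Prop :=
  affine_on (@segment R) g /\ set_fun (@segment R) X g.

(* The two notions below are meant for a convex subset [X]; a topological affine
   space is a topological vector space [F] once an origin is chosen. *)
Definition convex_on (R : realType) (F : topologicalLmodType R) (X : set F)
    (f : F -> R) : Prop :=
  {within X, continuous f} /\
  forall g : R^o -> F, affine_segment X g ->
    f (g 0) <= (f (g (-1)) + f (g 1)) / 2.

Definition strictly_convex_on (R : realType) (F : topologicalLmodType R)
    (X : set F) (f : F -> R) : Prop :=
  convex_on X f /\
  forall g : R^o -> F, affine_segment X g -> ~ constant_on (@segment R) g ->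
    f (g 0) < (f (g (-1)) + f (g 1)) / 2.

Definition Rplus (R : realType) : set R^o := `[0, +oo[.

Definition increasing_on (R : realType) (D : set R^o) (f : R^o -> R) : Prop :=
  forall x y : R^o, D x -> D y -> x < y -> f x < f y.

Definition unit_sphere (R : realType) (E : normedModType R) : set E :=
  [set x | `|x| = 1].

(* Main.v *)
Require Import Defs.
From mathcomp Require Import all_boot all_order all_algebra.
From mathcomp Require Import all_classical all_reals all_analysis.
From mathcomp Require Import ring lra.

Set Implicit Arguments.
Unset Strict Implicit.
Unset Printing Implicit Defensive.

Import Order.TTheory GRing.Theory Num.Theory.
Import numFieldNormedType.Exports.
Local Open Scope classical_set_scope.
Local Open Scope ring_scope.

(** For (1) => (2), [psi] is increasing and convex, so it suffices to treat a
    segment [[a, b]] for which the chain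
    [psi |(a + b) / 2| <= psi ((|a| + |b|) / 2) <= (psi |a| + psi |b|) / 2] is
    an equality. Strict convexity of [psi] forces [|a| = |b| = r], strict
    monotonicity forces the midpoint to have norm [r], and then convexity of
    the norm puts the whole segment on the sphere of radius [r]; rescaling and
    (1) give [a = b]. For (2) => (3), take [psi x = x ^+ 2]. For (3) => (1),
    [psi \o norm] is constant along any segment in the unit sphere. *)

Definition param_segment {R : realType} {F : lmodType R} (a b : F) (t : R) :
    F := ((1 - t) / 2) *: a + ((1 + t) / 2) *: b.

Lemma conv_lmodE (R : numDomainType) (F : lmodType R) (p : {i01 R}) (x y : F) :
  conv p (x : convex_lmodType F) y = p%:num *: x + (1 - p%:num) *: y.
Proof. by []. Qed.

(** * Affine maps on [[-1, 1]] and their endpoint values *)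

Section Segments.
Context {R : realType} {F : lmodType R}.
Implicit Types (a b : F) (g : R^o -> F).

Lemma segmentP (t : R) : segment t <-> (-1 <= t) /\ (t <= 1).
Proof.
by rewrite /segment /= in_itv /=; split => [/andP //|[-> ->]].
Qed.

Lemma segmentN1 : @segment R (-1). Proof. by apply/segmentP; split; lra. Qed.

Lemma segment1 : @segment R 1. Proof. by apply/segmentP; split; lra. Qed.

Lemma segment0 : @segment R 0. Proof. by apply/segmentP; split; lra. Qed.

Lemma param_segmentN1 a b : param_segment a b (-1) = a.
Proof.
rewrite /param_segment (_ : (1 - -1) / 2 = 1 :> R); last by field.
by rewrite subrr mul0r scale0r scale1r addr0.
Qed.

Lemma param_segment1 a b : param_segment a b 1 = b.
Proof.
rewrite /param_segment (_ : (1 + 1) / 2 = 1 :> R); last by field.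
by rewrite subrr mul0r scale0r scale1r add0r.
Qed.

Lemma param_segment0 a b : param_segment a b 0 = 2^-1 *: (a + b).
Proof. by rewrite /param_segment subr0 addr0 mul1r scalerDr. Qed.

Lemma scaler_param_segment (k : R) a b (t : R) :
  param_segment (k *: a) (k *: b) t = k *: param_segment a b t.
Proof. by rewrite /param_segment scalerDr !scalerA ![k * _]mulrC. Qed.

(** The weights of [a] at [t] and [- t] add up to 1, and so do those of [b]. Hence opposite
    parameters share the midpoint of [a] and [b]. *)
Lemma param_segment_sym a b (t : R) :
  param_segment a b t + param_segment a b (- t) = a + b.
Proof.
have scaleD1 (u v : R) (x : F) : u + v = 1 -> u *: x + v *: x = x.
  by move=> uv; rewrite -scalerDl uv scale1r.
by rewrite /param_segment addrACA !scaleD1 //; field.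
Qed.

Lemma affine_param_segment a b : affine_on (@segment R) (param_segment a b).
Proof.
move=> p x y _ _; rewrite !conv_lmodE /param_segment !scalerDr !scalerA.
rewrite addrACA -2!scalerDl /GRing.scale /=.
by congr (_ *: _ + _ *: _); field.
Qed.

Lemma affine_on_segmentE g : affine_on (@segment R) g ->
  {in @segment R, g =1 param_segment (g (-1)) (g 1)}.
Proof.
move=> ag t; rewrite inE => /segmentP [t1 t2].
have p0 : 0 <= (1 - t) / 2 by lra.
have p1 : (1 - t) / 2 <= 1 by lra.
(* With weight [(1 - t) / 2] on -1 and the rest on 1, the convex combination of the endpoints is [t]
   itself. *)
have := ag (Itv01 p0 p1) _ _ segmentN1 segment1.
rewrite !conv_lmodE /= /GRing.scale /= => E.
rewrite /param_segment -(_ : 1 - (1 - t) / 2 = (1 + t) / 2); last by field.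
by rewrite -E; congr g; field.
Qed.

Lemma affine_midpoint g : affine_on (@segment R) g ->
  g 0 = 2^-1 *: (g (-1) + g 1).
Proof.
move=> ag; rewrite affine_on_segmentE ?inE; last exact: segment0; last by [].
exact: param_segment0.
Qed.

(** Used in contrapositive form: a non-constant affine map has distinct endpoint values. *)
Lemma affine_constant_on g : affine_on (@segment R) g -> g (-1) = g 1 ->
  constant_on (@segment R) g.
Proof.
move=> ag g11; suff gE t : segment t -> g t = g 1.
  by move=> x y Dx Dy; rewrite !gE.
move=> Dt; rewrite affine_on_segmentE ?inE // g11 /param_segment -scalerDl.
by rewrite (_ : _ + _ = 1) ?scale1r //; field.
Qed.

End Segments.

(** * Midpoint convexity on the half-line, and the square function *)

Section NonnegativeReals.
Context {R : realType}.

Lemma RplusP (x : R^o) : Rplus x <-> 0 <= x.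
Proof. by rewrite /Rplus /= in_itv /= andbT. Qed.

Lemma param_segment_Rplus (a b : R^o) : 0 <= a -> 0 <= b ->
  affine_segment (@Rplus R) (param_segment a b).
Proof.
move=> a0 b0; split; first exact: affine_param_segment.
move=> t /segmentP [t1 t2]; apply/RplusP; rewrite /param_segment.
by apply: addr_ge0; apply: mulr_ge0 => //; lra.
Qed.

Lemma convex_on_Rplus_midpoint (psi : R^o -> R) (a b : R) :
  convex_on (@Rplus R) psi -> 0 <= a -> 0 <= b ->
  psi ((a + b) / 2) <= (psi a + psi b) / 2.
Proof.
move=> [_ cpsi] a0 b0; have := cpsi _ (param_segment_Rplus a0 b0).
by rewrite param_segment0 param_segmentN1 param_segment1 /GRing.scale /= mulrC.
Qed.

Lemma strictly_convex_on_Rplus_midpoint (psi : R^o -> R) (a b : R) :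
  strictly_convex_on (@Rplus R) psi -> 0 <= a -> 0 <= b -> a != b ->
  psi ((a + b) / 2) < (psi a + psi b) / 2.
Proof.
move=> [_ cpsi] a0 b0 ab; have := cpsi _ (param_segment_Rplus a0 b0).
rewrite param_segment0 param_segmentN1 param_segment1 /GRing.scale /= mulrC.
apply => /(_ _ _ segmentN1 segment1); rewrite param_segmentN1 param_segment1.
by move/eqP; apply/negP.
Qed.

Lemma increasing_sqr : increasing_on (@Rplus R) (fun x : R^o => x ^+ 2).
Proof. by move=> x y /RplusP x0 /RplusP y0 xy; rewrite ltr_pXn2r. Qed.

(** For endpoint values [u] and [v], the mean of the squares exceeds the square of the mean by
    [(u - v) ^+ 2 / 4]. *)
Lemma strictly_convex_sqr :
  strictly_convex_on (@Rplus R) (fun x : R^o => x ^+ 2).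
Proof.
split.
  split; first by apply: continuous_subspaceT => x; exact: exprn_continuous.
  move=> g [ag _]; rewrite affine_midpoint // /GRing.scale /=.
  by have := sqr_ge0 (g (-1) - g 1); nra.
move=> g [ag _] ncg; rewrite affine_midpoint // /GRing.scale /=.
have : g (-1) - g 1 != 0.
  by rewrite subr_eq0; apply/negP => /eqP /(affine_constant_on ag).
by rewrite -sqrf_eq0 => gn0; have := sqr_ge0 (g (-1) - g 1); nra.
Qed.

End NonnegativeReals.

(** * Strict convexity of the composition with the norm *)

Section NormedSpace.
Context {R : realType} {E : normedModType R}.
Implicit Types (a b : E) (psi : R^o -> R).

Lemma within_continuous_comp_norm psi :
  {within @Rplus R, continuous psi} ->
  {within [set: E], continuous (fun x : E => psi `|x|)}.
Proof.
move=> /subspace_continuousP cpsi.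
apply: continuous_subspaceT => x.
have Rx : Rplus (`|x| : R^o) by apply/RplusP.
apply: cvg_comp (cpsi _ Rx) => A /= wA.
(* [wA] concerns only the points of [Rplus] near the norm of [x]. It is pulled back along the
   continuous norm, whose values all lie in [Rplus]. *)
have : \forall y \near x, Rplus (`|y| : R^o) -> A `|y|.
  exact: (@norm_continuous _ E x) wA.
by apply: filterS => y; apply; apply/RplusP.
Qed.

Lemma ler_norm_midpoint a b : `|2^-1 *: (a + b)| <= (`|a| + `|b|) / 2.
Proof.
rewrite normrZ gtr0_norm ?invr_gt0 // mulrC ler_pM2r ?invr_gt0 //.
exact: ler_normD.
Qed.

Lemma ler_norm_param_segment (r : R) a b (t : R) : `|a| <= r -> `|b| <= r ->
  segment t -> `|param_segment a b t| <= r.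
Proof.
move=> ar br /segmentP [t1 t2]; apply: le_trans (ler_normD _ _) _.
have t0 : 0 <= (1 - t) / 2 by lra.
have t0' : 0 <= (1 + t) / 2 by lra.
by rewrite (normrZ _ a) (normrZ _ b) (ger0_norm t0) (ger0_norm t0'); nra.
Qed.

(* The points of parameters [t] and [- t] have norm at most [r] and the same
   midpoint as [a] and [b], so neither can have norm less than [r]. *)
Lemma norm_param_segment (r : R) a b (t : R) : `|a| <= r -> `|b| <= r ->
  r <= `|2^-1 *: (a + b)| -> segment t -> `|param_segment a b t| = r.
Proof.
move=> ar br rm Dt.
have Dmt : @segment R (- t) by move/segmentP: Dt => [? ?]; apply/segmentP; lra.
have tr := ler_norm_param_segment ar br Dt.
have mtr := ler_norm_param_segment ar br Dmt.
have := ler_norm_midpoint (param_segment a b t) (param_segment a b (- t)).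
rewrite param_segment_sym => h; lra.
Qed.

Hypothesis sphere_constant : forall g : R^o -> E,
  affine_segment (@unit_sphere R E) g -> constant_on (@segment R) g.

(** Otherwise [norm_param_segment] puts the whole segment on the sphere of radius [|a|], and
    dividing by [|a|] gives a non-constant affine map into the unit sphere, against
    [sphere_constant]. *)
Lemma norm_midpoint_lt a b : a != b -> `|a| = `|b| ->
  `|2^-1 *: (a + b)| < `|a|.
Proof.
move=> ab nab; rewrite ltNge; apply/negP => am.
(* If [a] were zero, equality of the norms would make [b] zero as well, contradicting [a != b]. *)
have a0 : 0 < `|a|.
  rewrite normr_gt0; apply: contraNneq ab => a0.
  by rewrite a0 eq_sym -normr_eq0 -nab a0 normr0.
suff /sphere_constant/(_ _ _ segmentN1 segment1) :
    affine_segment (@unit_sphere R E)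
      (param_segment (`|a|^-1 *: a) (`|a|^-1 *: b)).
  rewrite param_segmentN1 param_segment1.
  by move/(scalerI (invr_neq0 (lt0r_neq0 a0))) => /eqP; apply/negP.
split; first exact: affine_param_segment.
move=> t Dt; rewrite /unit_sphere /= scaler_param_segment normrZ.
rewrite (norm_param_segment _ _ am Dt) -?nab //.
by rewrite gtr0_norm ?invr_gt0 // mulVf // gt_eqF.
Qed.

Lemma strictly_convex_comp_norm psi :
  increasing_on (@Rplus R) psi -> strictly_convex_on (@Rplus R) psi ->
  strictly_convex_on [set: E] (fun x : E => psi `|x|).
Proof.
move=> ipsi spsi; have cpsi := spsi.1.
have psi_norm_le (x : E) (s : R) : `|x| <= s -> psi `|x| <= psi s.
  rewrite le_eqVlt => /predU1P [->//|xs]; apply/ltW/ipsi => //; apply/RplusP.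
    exact: normr_ge0.
  exact: le_trans (normr_ge0 x) (ltW xs).
have mid a b := convex_on_Rplus_midpoint cpsi (normr_ge0 a) (normr_ge0 b).
split.
  split; first exact: within_continuous_comp_norm cpsi.1.
  move=> g [ag _]; rewrite affine_midpoint //.
  apply: le_trans (mid _ _); exact/psi_norm_le/ler_norm_midpoint.
move=> g [ag _] ncg; rewrite affine_midpoint //.
have gn : g (-1) != g 1 by apply/eqP => /(affine_constant_on ag).
(* For distinct endpoint norms, strictness comes from the strict convexity of [psi]. For equal ones,
   it comes from the midpoint having smaller norm and [psi] being increasing. *)
have [ng|ng] := eqVneq `|g (-1)| `|g 1|; last first.
  apply: le_lt_trans (psi_norm_le _ _ (ler_norm_midpoint _ _)) _.
  exact: strictly_convex_on_Rplus_midpoint.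
have -> : (psi `|g (-1)| + psi `|g 1|) / 2 = psi `|g (-1)|.
  by rewrite -ng; field.
by apply: ipsi; rewrite ?RplusP //; [apply/RplusP..|exact: norm_midpoint_lt].
Qed.

End NormedSpace.

Theorem theorem17 (R : realType) (E : normedModType R) :
  let cond1 :=
    forall g : R^o -> E, affine_segment (@unit_sphere R E) g ->
      constant_on (@segment R) g in
  let cond2 :=
    forall psi : R^o -> R,
      increasing_on (@Rplus R) psi -> strictly_convex_on (@Rplus R) psi ->
      strictly_convex_on [set: E] (fun x : E => psi `|x|) in
  let cond3 :=
    exists psi : R^o -> R,
      [/\ increasing_on (@Rplus R) psi, strictly_convex_on (@Rplus R) psi &
          strictly_convex_on [set: E] (fun x : E => psi `|x|)] in
  (cond1 <-> cond2) /\ (cond2 <-> cond3).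
Proof.
move=> cond1 cond2 cond3.
have c12 : cond1 -> cond2 by move=> c1 psi; exact: strictly_convex_comp_norm.
have c23 : cond2 -> cond3.
  move=> c2; exists (fun x => x ^+ 2).
  have i2 := @increasing_sqr R; have s2 := @strictly_convex_sqr R.
  by split => //; exact: (c2 _ i2 s2).
have c31 : cond3 -> cond1.
  move=> [psi [_ _ [_ snorm]]] g [ag gS]; apply: contrapT => ncg.
  have gT : affine_segment [set: E] g by [].
  have gE t : segment t -> `|g t| = 1 by exact: gS.
  (* All three norms are 1, so strict convexity would give [psi 1 < (psi 1 + psi 1) / 2]. *)
  have := snorm g gT ncg.
  by rewrite !gE ?ltxx; [lra|exact: segment1|exact: segmentN1|exact: segment0].
split; split => //; first by move=> /c23 /c31.
by move=> /c31 /c12.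
Qed.
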